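(* Let $\nu>0$, $\mathbf p\in\mathbb Z^2\setminus\{0\}$, and let $\mathbf q\in\mathcal Q(\mathbf p)$ be not parallel to $\mathbf p$. For $\lambda>0$ the following are equivalent: (i) $\lambda$ is an eigenvalue of the operator $L_{B,\mathbf q}$; (ii) $\det(I+K_\lambda)=0$; (iii) $-1\in\sigma_p(K_\lambda)$.
   Context: $\|\cdot\|$ is the Euclidean norm. For $\mathbf q\in\mathbb Z^2$ let $\widehat{\mathbf q}$ be the point of smallest norm in $\{\mathbf q+n\mathbf p:n\in\mathbb Z\}$ (if there are two, the one with larger $n$), and $\mathcal Q(\mathbf p)=\{\widehat{\mathbf q}:\mathbf q\in\mathbb Z^2\}$. Set $\rho_n=1-\frac{\|\mathbf p\|^2}{\|\mathbf q+n\mathbf p\|^2}$, $n\in\mathbb Z$. $L_{B,\mathbf q}$ is the unbounded operator in $\ell^2(\mathbb Z)$, with domain the sequences such that $(n^2w_n)\in\ell^2(\mathbb Z)$, given by $$L_{B,\mathbf q}:(w_n)_{n\in\mathbb Z}\mapsto(\rho_{n-1}w_{n-1}-\rho_{n+1}w_{n+1}-\nu\|\mathbf q+n\mathbf p\|^2w_n)_{n\in\mathbb Z}.$$ (This is the restriction to Fourier modes $\mathbf q+n\mathbf p$ of the 2D Navier-Stokes vorticity operator linearized about $\omega^0=\Gamma\cos(\mathbf p\cdot\mathbf x)$, with $\Gamma$ normalized by $\Gamma(\mathbf q\wedge\mathbf p)/(2\|\mathbf p\|^2)=1$, where $\mathbf q\wedge\mathbf p=q_1p_2-q_2p_1$.)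 Let $S:(w_n)\mapsto(w_{n-1})$ be the shift on $\ell^2(\mathbb Z)$ and $S^*$ its adjoint. For $\lambda>0$, $$K_\lambda=\operatorname{diag}\{(-\nu\|\mathbf q+n\mathbf p\|^2-\lambda)^{-1}\}\,(S-S^* )\,\operatorname{diag}\{\rho_n\},$$ a trace class operator on $\ell^2(\mathbb Z)$. $\det(I+K_\lambda)=\prod_n(1+\kappa^n_\lambda)$ is its Fredholm (perturbation) determinant, the product being over all eigenvalues $\kappa^n_\lambda$ of $K_\lambda$ (counted with algebraic multiplicity). $\sigma_p$ denotes the point spectrum. *)

(* Defs.v *)
From HB Require Import structures.
From mathcomp Require Import all_boot all_order all_algebra.
From mathcomp Require Import finmap.
From mathcomp Require Import complex.
From mathcomp Require Import all_classical all_reals all_analysis.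
From mathcomp.analysis.showcase Require summability.
Set Implicit Arguments.
Unset Strict Implicit.
Unset Printing Implicit Defensive.
Import Order.TTheory GRing.Theory Num.Theory.
Import numFieldNormedType.Exports.
Local Open Scope classical_set_scope.
Local Open Scope ring_scope.

(* R[i], packaged so that the topology of a numClosedFieldType is found. *)
Definition Cplx (R : realType) : numClosedFieldType := R[i].

Definition ofR (R : realType) (x : R) : Cplx R := real_complex R x.

Section Lattice.
Variable R : realType.

Definition enorm (q : int * int) : R :=
  Num.sqrt (q.1%:~R ^+ 2 + q.2%:~R ^+ 2).

Definition wedge (q p : int * int) : int := q.1 * p.2 - q.2 * p.1.

Definition parallel (q p : int * int) : Prop := wedge q p = 0.

(* [is_hat p q q'] : q' is the point of smallest norm on the line q + Zp, the
   one with the larger n in case of a tie. *)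
Definition is_hat (p q q' : int * int) : Prop :=
  exists n : int, [/\ q' = q + p *~ n,
    forall m : int, enorm q' <= enorm (q + p *~ m) &
    forall m : int, enorm (q + p *~ m) = enorm q' -> m <= n].

Definition Qset (p : int * int) : set (int * int) :=
  [set q' | exists q, is_hat p q q'].

Definition rho (p q : int * int) (n : int) : R :=
  1 - enorm p ^+ 2 / enorm (q + p *~ n) ^+ 2.

End Lattice.

Definition zseq (R : realType) := int -> Cplx R.

Section Operators.
Variable R : realType.
Local Notation C := (Cplx R).
Local Notation zseq := (zseq R).

Definition ell2 : set zseq :=
  [set w | (\esum_(n in [set: int]) (complex.Re (`|w n| ^+ 2))%:E < +oo)%E].

(* A possibly unbounded operator in ell2; the values of [act] outside [dom]
   are irrelevant. *)
Record operator := Operator { dom : set zseq; act :> zseq -> zseq }.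

Definition point_spectrum (T : operator) : set C :=
  [set k | exists w, [/\ dom T w, w <> 0 & T w = k *: w]].

Definition gen_eigenspace (T : operator) (k : C) : set zseq :=
  [set w | exists m : nat,
     (forall j, (j <= m)%N -> dom T (iter j (fun u => T u - k *: u) w)) /\
     iter m (fun u => T u - k *: u) w = 0].

Definition has_dim (V : set zseq) (m : nat) : Prop :=
  exists b : 'I_m -> zseq,
    [/\ forall i, V (b i),
        forall c : 'I_m -> C, \sum_i c i *: b i = 0 -> forall i, c i = 0 &
        forall v, V v -> exists c : 'I_m -> C, v = \sum_i c i *: b i].

(* Junk value 0 if the generalized eigenspace is infinite dimensional; for a
   compact T this can only happen at k = 0, whose factor 1 + k in the
   determinant is 1 anyway. *)
Definition alg_mult (T : operator) (k : C) : nat :=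
  xget 0%N [set m | has_dim (gen_eigenspace T k) m].

(* The unordered product of 1 + k over all eigenvalues k of T, counted with
   algebraic multiplicity: the limit of the finite products along the finite
   sets of complex numbers, directed by inclusion. It converges when T is trace
   class; otherwise [lim] may return its default value 0. *)
Definition fredholm_det (T : operator) : C :=
  lim ((fun A : {fset C} =>
          \prod_(k <- A | k \in point_spectrum T) (1 + k) ^+ alg_mult T k)
       @ @summability.totally C).

(* S and its adjoint for the inner product [dotz] (see [shiftz_adjE]). *)
Definition shiftz (w : zseq) : zseq := fun n => w (n - 1).

Definition shiftz_adj (w : zseq) : zseq := fun n => w (n + 1).

Definition dotz (v w : zseq) : C := summability.sum (fun n => v n * (w n)^*).

Lemma sum_shift (x : int -> C) :
  summability.sum (fun n => x (n + 1)) = summability.sum x.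
Proof.
pose tr (c : int) (A : {fset int}) := [fset (i + c)%R | i in A]%fset.
have trK c A : tr c (tr (- c) A) = A.
  apply/fsetP => i; apply/imfsetP/idP => /= [[j /imfsetP[k /= kA ->] ->]|iA].
    by rewrite subrK.
  by exists (i - c); rewrite ?subrK//; apply/imfsetP; exists i.
have trS c A B : (A `<=` B)%fset -> (tr c A `<=` tr c B)%fset.
  move=> /fsubsetP AB; apply/fsubsetP => i /imfsetP[j /= jA ->].
  by apply/imfsetP; exists j => //=; exact: AB.
rewrite /summability.sum; congr (lim _); apply/seteqP.
have sumE A : summability.partial_sum (fun n => x (n + 1)) A =
              summability.partial_sum x (tr 1 A).
  rewrite /summability.partial_sum.
  rewrite -(big_seq_fsetE _ _ xpredT (fun n => x (n + 1))).
  rewrite -(big_seq_fsetE _ _ xpredT x) big_imfset//=.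
  by move=> i j _ _; exact: addIr.
split=> P [A _ AP].
- exists (tr 1 A) => // B AB; rewrite /= -(trK 1 B) -sumE; apply: AP => /=.
  by rewrite -(trK (- 1) A) opprK; exact: trS.
- exists (tr (- 1) A) => // B AB; rewrite /= sumE; apply: AP => /=.
  by rewrite -(trK 1 A); exact: trS.
Qed.

Lemma shiftz_adjE (v w : zseq) : dotz (shiftz v) w = dotz v (shiftz_adj w).
Proof.
rewrite /dotz -sum_shift; congr summability.sum; apply/funext => n.
by rewrite /shiftz addrK.
Qed.

Definition diag (d : int -> R) (w : zseq) : zseq := fun n => ofR (d n) * w n.

Definition LB (nu : R) (p q : int * int) : operator := Operator
  [set w | ell2 w /\ ell2 (fun n => n%:~R ^+ 2 * w n)]
  (fun w n => ofR (rho R p q (n - 1)) * w (n - 1)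
     - ofR (rho R p q (n + 1)) * w (n + 1)
     - ofR (nu * enorm R (q + p *~ n) ^+ 2) * w n).

Definition Kop (nu : R) (p q : int * int) (lam : R) : operator := Operator
  ell2
  (fun w =>
     let u := diag (rho R p q) w in
     diag (fun n => (- nu * enorm R (q + p *~ n) ^+ 2 - lam)^-1)
       (shiftz u - shiftz_adj u)).

End Operators.

(* Main.v *)
Require Import Defs.
From mathcomp Require Import all_boot all_order all_algebra.
From mathcomp Require Import finmap complex.
From mathcomp Require Import all_classical all_reals all_analysis.
From mathcomp.analysis.showcase Require summability.
From mathcomp Require Import ring lra.

(** Write [K = D H], where [D] is the diagonal operator with the entries
    [d_n = (- nu |q + n p|^2 - lam)^-1] and [H w = S (rho w) - S' (rho w)], [S']
    being the adjoint of the shift [S].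

    The equations [L w = lam w] and [K w = - w] differ by the nonzero factors
    [d_n] ([LB_eigen]). The domains match because [d_n] is of order [n^-2]: a
    square summable [w = - D H w] is such that [n^2 w_n] is square summable
    ([Kop_eigen_dom]).

    That the determinant vanishes exactly when [-1] is an eigenvalue of [K] is
    about an infinite product. If [-1] is an eigenvalue, the product has a zero
    factor, as soon as the multiplicity of [-1] is a positive finite number. If
    it is not, no factor is zero, but one has to know that the product converges
    and that its limit is not zero, which follows from the convergence of
    [\sum_k m(k) |k|], where [m(k)] is the algebraic multiplicity of [k]
    ([infinite_product]). Both facts come from one estimate, an
    elementary case of Weyl's inequality between eigenvalues and singular
    values.

    Consider orthonormal [e_1, ..., e_N] and numbers [k_1, ..., k_N] such that
    [K e_j - k_j e_j] is in the span of the preceding vectors, as in the Schur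
    form of a matrix ([schur_list]). Then [k_j = <K e_j, e_j>], so
    [\sum_j |k_j| <= \sum_n |d_n| \sum_j |(H e_j)_n| |(e_j)_n|], and by Bessel's
    inequality for the coordinate forms [w |-> w_n] the inner sum is at most
    [4 \sup_n |rho_n|] ([bessel], [schur_trace_le]). The bound does not depend on
    the family.

    As long as such a family does not span the generalized eigenspace of [k], it
    can be extended by a vector of label [k], obtained by Gram-Schmidt
    ([schur_list_extend]). For [k <> 0] the bound on [\sum_j |k_j|] stops this
    process. Hence the generalized eigenspaces of nonzero eigenvalues have finite
    dimension, and any finitely many of them lie in the span of one family
    ([schur_list_covers]). In that family [k] occurs as a label at least [m(k)]
    times ([geneig_schur_list]), so that [\sum_k m(k) |k|] satisfies the same
    bound ([sum_alg_mult_le]). *)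

Set Implicit Arguments.
Unset Strict Implicit.
Unset Printing Implicit Defensive.
Import Order.TTheory GRing.Theory Num.Theory.
Import numFieldNormedType.Exports.
Local Open Scope classical_set_scope.
Local Open Scope ring_scope.

(** * Spans of finite lists of vectors *)

Section Span.
Variables (F : fieldType) (V : lmodType F).
Implicit Types (es bs : seq V) (u v w : V) (W : V -> Prop).

(** The recursion exposes the coefficient of the head, on which the inductions
    below pivot; [spanP] is the description by linear combinations. *)
Fixpoint lspan es v : Prop :=
  if es is e :: es' then exists c, lspan es' (v - c *: e) else v = 0.

Fixpoint indep es : Prop :=
  if es is e :: es' then ~ lspan es' e /\ indep es' else True.

Definition is_subspace W : Prop :=
  W 0 /\ forall a u v, W u -> W v -> W (a *: u + v).

Lemma subspace_span es : is_subspace (lspan es).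
Proof.
elim: es => [|e es [IH0 IH]]; split=> //=.
- by move=> a u v -> ->; rewrite scaler0 addr0.
- by exists 0; rewrite scale0r subr0.
- move=> a u v [c Hc] [d Hd]; exists (a * c + d).
  rewrite scalerDl -scalerA opprD addrACA -scalerBr; exact: IH.
Qed.

Lemma subspaceI W1 W2 : is_subspace W1 -> is_subspace W2 ->
  is_subspace (fun v => W1 v /\ W2 v).
Proof.
move=> [z1 H1] [z2 H2]; split=> // a u v [? ?] [? ?].
by split; [apply: H1|apply: H2].
Qed.

Section SubspaceOps.
Variable W : V -> Prop.
Hypothesis HW : is_subspace W.

Lemma subspaceD u v : W u -> W v -> W (u + v).
Proof. by move=> Wu Wv; rewrite -[u]scale1r; apply: HW.2. Qed.

Lemma subspaceZ a u : W u -> W (a *: u).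
Proof.
by move=> Wu; rewrite -[_ *: _]addr0; apply: HW.2 => //; exact: HW.1.
Qed.

Lemma subspaceB u v : W u -> W v -> W (u - v).
Proof. by move=> Wu Wv; rewrite addrC -scaleN1r; apply: HW.2. Qed.

Lemma subspace_sum (I : Type) (r : seq I) (c : I -> F) (b : I -> V) :
  (forall i, W (b i)) -> W (\sum_(i <- r) c i *: b i).
Proof.
move=> Wb; elim: r => [|i r IH]; first by rewrite big_nil; exact: HW.1.
by rewrite big_cons; apply: HW.2.
Qed.

End SubspaceOps.

Lemma span_cons e es v : lspan es v -> lspan (e :: es) v.
Proof. by exists 0; rewrite scale0r subr0. Qed.

Lemma span_head e es : lspan (e :: es) e.
Proof. by exists 1; rewrite scale1r subrr; exact: (subspace_span _).1. Qed.

Lemma spanP es v : lspan es v <->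
  exists c : 'I_(size es) -> F, v = \sum_i c i *: es`_i.
Proof.
split; last first.
  move=> [c ->]; apply: subspace_sum; first exact: subspace_span.
  case=> i /=; elim: es i {c} => // e es IH [|i] /= ilt; first exact: span_head.
  exact/span_cons/IH.
elim: es v => [|e es IH] v /=.
  by move=> ->; exists (fun=> 0); rewrite big_ord0.
move=> [a /IH[c Hc]].
exists (fun i => if unlift ord0 i is Some j then c j else a).
rewrite big_ord_recl unlift_none /=.
under eq_bigr do rewrite liftK.
by rewrite -Hc addrC subrK.
Qed.

(** Along the flag of spans of the tails of [es], the trace of [W] either stays
    the same or grows by the line of one vector [w]; in the second case a multiple
    of [w] corrects any vector of [W] into the smaller span. *)
Lemma subspace_basis W es : is_subspace W -> (forall v, W v -> lspan es v) ->
  exists bs, indep bs /\ forall v, W v <-> lspan bs v.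
Proof.
elim: es W => [|e es IH] W HW Wes.
  exists [::]; split=> // v; split=> [/Wes//|/= ->]; exact: HW.1.
have [bs [fbs bsP]] :=
  IH _ (subspaceI HW (subspace_span es)) (fun v => @proj2 _ _).
have [Wsub|] := pselect (forall v, W v -> lspan es v).
  exists bs; split=> // v; rewrite -bsP.
  by split=> [Wv|[]//]; split=> //; exact: Wsub.
move=> /existsNP[w /not_implyP[Ww esw]].
exists (w :: bs); split=> /=; first by split=> // /bsP[].
have [c cw] := Wes _ Ww.
have c0 : c != 0.
  by apply: contra_notN esw => /eqP c0; rewrite c0 scale0r subr0 in cw.
move=> v; split=> [Wv|[d /bsP[Wvd _]]]; last first.
  by rewrite -(subrK (d *: w) v); apply: subspaceD => //; apply: subspaceZ.
have [d dv] := Wes _ Wv.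
exists (d / c); apply/bsP; split.
  by apply: subspaceB => //; apply: subspaceZ.
have -> : v - d / c *: w = (v - d *: e) - (d / c) *: (w - c *: e).
  by rewrite scalerBr scalerA divfK// opprB addrA subrK.
have sp := subspace_span es.
exact: (subspaceB sp dv (subspaceZ sp _ cw)).
Qed.

Lemma indep_coef es (c : 'I_(size es) -> F) : indep es ->
  \sum_i c i *: es`_i = 0 -> forall i, c i = 0.
Proof.
elim: es c => [|e es IH] c /=; first by move=> _ _ [].
move=> [esN fes]; rewrite big_ord_recl /= => s0.
have c0 : c ord0 = 0.
  apply/eqP; apply: contra_notT esN => c0; apply/spanP.
  exists (fun i => - (c ord0)^-1 * c (lift ord0 i)).
  under eq_bigr do rewrite -scalerA.
  move/eqP: s0; rewrite -scaler_sumr addrC addr_eq0 => /eqP ->.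
  by rewrite scalerN scaleNr opprK scalerA mulVf// scale1r.
move: s0; rewrite c0 scale0r add0r => /(IH _ fes) ci0 i.
by case: (unliftP ord0 i) => [j ->|->//]; exact: ci0.
Qed.

(** If [bs] were shorter than the family [b], the matrix of the coefficients of
    [b] on [bs] would have a nonzero left kernel, that is, a linear relation. *)
Lemma indep_size m (b : 'I_m -> V) bs :
  (forall c : 'I_m -> F, \sum_i c i *: b i = 0 -> forall i, c i = 0) ->
  (forall i, lspan bs (b i)) -> (m <= size bs)%N.
Proof.
move=> fb /(_ _)/spanP/cid bbs.
pose A := \matrix_(i < m, j < size bs) (sval (bbs i)) j.
rewrite leqNgt; apply/negP => ltm.
have kerA : kermx A != 0.
  rewrite kermx_eq0 /row_free; apply: contraTneq (rank_leq_col A) => ->.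
  by rewrite -ltnNge.
have /rowV0Pn[x xker x0] := kerA.
have xA : x *m A = 0 by exact/sub_kermxP.
case/eqP: x0; apply/rowP => i; rewrite mxE.
apply: (fb (fun i => x 0 i)).
rewrite (eq_bigr (fun i => \sum_j (x 0 i * A i j) *: bs`_j)); last first.
  move=> k _; rewrite {1}(svalP (bbs k)) scaler_sumr; apply: eq_bigr => j _.
  by rewrite scalerA mxE.
rewrite exchange_big /= big1// => j _; rewrite -scaler_suml.
by move/matrixP: xA => /(_ 0 j); rewrite !mxE => ->; rewrite scale0r.
Qed.

End Span.

(** * Orthonormal triangular lists *)

(** [D] stands for the set [ell2], on which alone the inner product of sequences
    is meaningful. *)
Section TriangularLists.
Variables (C : numClosedFieldType) (V : lmodType C).
Variables (D : V -> Prop) (dot : V -> V -> C) (K : V -> V).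
Hypothesis (HD : is_subspace D) (linK : linear K).
Hypothesis (DK : forall u, D u -> D (K u)).
Hypothesis (dotP : forall a u v w, D u -> D v -> D w ->
  dot (a *: u + v) w = a * dot u w + dot v w).
Hypothesis (dot_conj : forall u v, D u -> D v -> dot v u = (dot u v)^*).
Hypothesis (dot_gt0 : forall u, D u -> u <> 0 -> 0 < dot u u).

Definition geneig (k : C) (v : V) : Prop :=
  D v /\ exists m, iter m (fun u => K u - k *: u) v = 0.

(** Pairs of an eigenvalue and a vector; most recent vector first. In the basis
    of the vectors [K] is triangular, with the eigenvalues on the diagonal. *)
Fixpoint schur_list (l : seq (C * V)) : Prop :=
  if l is (k, e) :: l' then
    [/\ D e, dot e e = 1, forall x, lspan (unzip2 l') x -> dot e x = 0,
        lspan (unzip2 l') (K e - k *: e) & schur_list l']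
  else True.

Let T k u := K u - k *: u.

Let linT k : linear (T k).
Proof.
move=> a u v; rewrite /T linK scalerBr scalerDr [k *: (a *: u)]scalerA mulrC.
by rewrite -scalerA opprD addrACA.
Qed.

Let T0 k : T k 0 = 0.
Proof. by have := linT k (-1) 0 0; rewrite scaler0 addr0 scaleN1r addNr. Qed.

Let TZ k a u : T k (a *: u) = a *: T k u.
Proof. by have := linT k a u 0; rewrite T0 !addr0. Qed.

Let TB k u v : T k (u - v) = T k u - T k v.
Proof. by rewrite addrC -scaleN1r linT scaleN1r addrC. Qed.

Let DT k u : D u -> D (T k u).
Proof. by move=> Du; apply: subspaceB => //; [exact: DK|exact: subspaceZ]. Qed.

Lemma subspace_geneig k : is_subspace (geneig k).
Proof.
have lin_iter m : linear (iter m (T k)).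
  by elim: m => // m IH a u v /=; rewrite IH linT.
have iter0 m : iter m (T k) 0 = 0 by elim: m => //= m ->.
split; first by split; [exact: HD.1|exists 0%N].
move=> a u v [Du [m mu]] [Dv [n nv]]; split; first exact: HD.2.
exists (m + n)%N; have -> : iter (m + n) (T k) (a *: u + v) = 0 => //.
rewrite lin_iter (iterD m n _ v) (_ : iter n _ v = 0) // iter0 addr0.
rewrite addnC iterD (_ : iter m _ u = 0) // iter0.
by rewrite scaler0.
Qed.

Lemma schur_list_dom l x : schur_list l -> lspan (unzip2 l) x -> D x.
Proof.
elim: l x => [|[k e] l IH] x /=; first by move=> _ ->; exact: HD.1.
move=> [De _ _ _ tl] [c /IH] /(_ tl) Dx.
by rewrite -(subrK (c *: e) x); apply: subspaceD => //; apply: subspaceZ.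
Qed.

Lemma schur_list_mem l x : schur_list l -> x \in l -> D x.2.
Proof.
elim: l => [|[k e] l IH] //= [De _ _ _ tl].
by rewrite inE => /predU1P[-> //|]; exact: IH.
Qed.

Lemma schur_list_stable k l x : schur_list l ->
  lspan (unzip2 l) x -> lspan (unzip2 l) (T k x).
Proof.
elim: l x => [|[k' e] l IH] x /=; first by move=> _ ->; exact: T0.
move=> [De _ _ eK tl] [c cx].
exists (c * (k' - k)).
have -> : T k x - (c * (k' - k)) *: e
          = c *: (K e - k' *: e) + T k (x - c *: e).
  rewrite TB TZ addrCA -scalerBr; congr (_ + _).
  rewrite /T opprB [X in c *: X]addrC addrA subrK -scalerBl scalerA.
  by rewrite -scaleNr -mulrN opprB.
apply: (subspace_span _).2 => //; exact: IH.
Qed.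

Lemma dot0l u v : D u -> D v -> dot u v = 0 -> dot v u = 0.
Proof. by move=> Du Dv uv; rewrite dot_conj// uv rmorph0. Qed.

Lemma dotPr a u v w : D u -> D v -> D w ->
  dot w (a *: u + v) = a^* * dot w u + dot w v.
Proof.
move=> Du Dv Dw; rewrite dot_conj//; last exact: HD.2.
by rewrite dotP// rmorphD rmorphM /= -!dot_conj.
Qed.

Lemma schur_list_diag l : schur_list l ->
  [seq dot (K x.2) x.2 | x <- l] = unzip1 l.
Proof.
elim: l => [|[k e] l IH] //= [De ee eo eK tl]; rewrite IH//; congr (_ :: _).
rewrite -(subrK (k *: e) (K e)) addrC dotP//; last exact: schur_list_dom eK.
rewrite ee mulr1 [X in _ + X]dot0l ?addr0//; first exact: schur_list_dom eK.
exact: eo.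
Qed.

(** Orthogonal projection onto the span, by Gram-Schmidt. *)
Lemma schur_list_proj l v : schur_list l -> D v ->
  exists u, lspan (unzip2 l) u /\
    forall x, lspan (unzip2 l) x -> dot (v - u) x = 0.
Proof.
elim: l => [|[k e] l IH] /=.
  move=> _ Dv; exists 0; split=> // _ ->; rewrite subr0.
  have := dotPr (-1) HD.1 HD.1 Dv.
  by rewrite scaler0 addr0 rmorphN1 mulN1r addNr.
move=> [De ee eo eK tl] Dv; have [u [ul uo]] := IH tl Dv.
have Du : D u by exact: schur_list_dom ul.
pose c := dot (v - u) e.
have Dvu : D (v - u) by exact: subspaceB.
exists (c *: e + u); split.
  by exists c; rewrite addrC addKr.
move=> x [a ax]; have Dx := schur_list_dom tl ax.
have -> : v - (c *: e + u) = - c *: e + (v - u) by rewrite opprD addrCA scaleNr.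
rewrite -(subrK (a *: e) x) [_ - _ + _]addrC dotPr//; last exact: HD.2.
by rewrite !dotP// ee (uo _ ax) (eo _ ax) mulr0 addr0 addr0 mulr1 addNr mulr0.
Qed.

(** In the sequence [w, (K - k) w, (K - k)^2 w, ...], which ends with [0], the
    last vector [v] outside the span is sent into it by [K - k]. Removing from [v]
    its projection onto the span, which is stable, and normalizing gives [e]. *)
Lemma schur_list_extend l k w : schur_list l -> geneig k w ->
  ~ lspan (unzip2 l) w -> exists e, schur_list ((k, e) :: l).
Proof.
move=> tl [Dw [m mw]] lw.
have [v [Dv lv lTv]] : exists v,
    [/\ D v, ~ lspan (unzip2 l) v & lspan (unzip2 l) (T k v)].
  elim: m w Dw mw lw => [|m IH] w Dw mw lw.
    by case: lw; rewrite /= in mw; rewrite mw; exact: (subspace_span _).1.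
  have [lTw|lTw] := pselect (lspan (unzip2 l) (T k w)); first by exists w.
  by apply: (IH (T k w)) => //; [exact: DT|rewrite -iterSr].
have [u [lu uo]] := schur_list_proj tl Dv.
have Du : D u by exact: schur_list_dom lu.
have Dvu : D (v - u) by exact: subspaceB.
have vu0 : v - u <> 0.
  by move=> /eqP; rewrite subr_eq0 => /eqP vu; apply: lv; rewrite vu.
have d0 := dot_gt0 Dvu vu0.
pose s := sqrtC (dot (v - u) (v - u)).
have s0 : 0 < s by rewrite sqrtC_gt0.
have dotZ a b x y : D x -> D y -> dot (a *: x) (b *: y) = a * (b^* * dot x y).
  move=> Dx Dy; have H := HD.1.
  have d0l z : D z -> dot 0 z = 0.
    by move=> Dz; have := dotP (-1) H H Dz; rewrite scaler0 addr0 mulN1r addNr.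
  have d0r z : D z -> dot z 0 = 0 by move=> Dz; exact/dot0l/d0l.
  have Dby : D (b *: y) by exact: subspaceZ.
  rewrite -[a *: x]addr0 dotP// d0l// addr0 -[b *: y]addr0 dotPr// d0r//.
  by rewrite addr0.
exists (s^-1 *: (v - u)); split=> //.
- exact: subspaceZ.
- rewrite dotZ// mulrA (CrealP _); last by rewrite rpredV; exact/gtr0_real.
  by rewrite -invfM -expr2 sqrtCK mulVf// gt_eqF.
- move=> x lx; rewrite -[x]scale1r dotZ// ?uo ?mulr0//.
  exact: schur_list_dom lx.
- rewrite -/(T k _) TZ; apply: subspaceZ; first exact: subspace_span.
  rewrite TB; apply: subspaceB => //; first exact: subspace_span.
  exact: schur_list_stable.
Qed.

(** The multiplicity of [k] in the span is at most the number of labels [k]: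
    modulo the span of the tail, [K - k] multiplies a head of label [k'] by
    [k' - k], so that only a head of label [k] can enlarge the trace of the
    generalized eigenspace, and by one dimension at most. *)
Lemma geneig_schur_list k l : schur_list l ->
  exists bs, (size bs <= count_mem k (unzip1 l))%N /\
    forall v, geneig k v -> lspan (unzip2 l) v -> lspan bs v.
Proof.
elim: l => [|[k' e] l IH] /=; first by exists [::].
move=> [De _ _ eK tl]; have [bs [sbs bsP]] := IH tl.
have [_|k'k] := eqVneq k' k; last first.
  exists bs; split=> // v [Dv [m mv]] [c cv].
  apply: bsP => //; first by split=> //; exists m.
  have itP n : exists x, lspan (unzip2 l) x /\
      iter n (T k) v = (c * (k' - k) ^+ n) *: e + x.
    elim: n => [|n [x [lx IHn]]] /=.
      by exists (v - c *: e); split=> //; rewrite expr0 mulr1 addrC subrK.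
    set a := c * _ ^+ n in IHn.
    exists (a *: (K e - k' *: e) + T k x); split.
      apply: (subspace_span _).2 => //; exact: schur_list_stable.
    have Te : T k e = (k' - k) *: e + (K e - k' *: e).
      by rewrite scalerBl [RHS]addrC addrA subrK.
    by rewrite IHn linT Te scalerDr scalerA -mulrA -exprSr [RHS]addrA.
  have [x [lx]] := itP m.
  rewrite [LHS]mv => /eqP; rewrite eq_sym addr_eq0 => /eqP ex.
  have [c0|c0] := eqVneq c 0; first by move: cv; rewrite c0 scale0r subr0.
  have a0 : c * (k' - k) ^+ m != 0 by rewrite mulf_neq0// expf_neq0// subr_eq0.
  have le : lspan (unzip2 l) e.
    rewrite -[e]scale1r -(mulVf a0) -scalerA ex.
    have sp := subspace_span (unzip2 l); apply: (subspaceZ sp).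
    by rewrite -[- x]add0r; exact: (subspaceB sp sp.1 lx).
  have sp := subspace_span (unzip2 l).
  by rewrite -(subrK (c *: e) v); apply: (subspaceD sp cv); exact: subspaceZ.
have [sub|] := pselect (forall v, geneig k v ->
    lspan (e :: unzip2 l) v -> lspan (unzip2 l) v).
  exists bs; split; first by rewrite (leq_trans sbs)// leq_addl.
  by move=> v gv lv; apply: bsP => //; exact: sub.
move=> /existsNP[w /not_implyP[gw /not_implyP[[c cw] lw]]].
exists (w :: bs); split; first by rewrite add1n ltnS.
have c0 : c != 0.
  by apply: contra_notN lw => /eqP c0; rewrite c0 scale0r subr0 in cw.
move=> v gv [d dv]; exists (d / c).
apply: bsP.
  have sp := subspace_geneig k.
  exact: (subspaceB sp gv (subspaceZ sp _ gw)).
have -> : v - d / c *: w = (v - d *: e) - (d / c) *: (w - c *: e).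
  by rewrite scalerBr scalerA divfK// opprB addrA subrK.
have sp := subspace_span (unzip2 l).
exact: (subspaceB sp dv (subspaceZ sp _ cw)).
Qed.

(** Each extension adds a label [k], so at most [N] of them are possible. *)
Lemma schur_list_cover l k N :
  (forall l', schur_list l' -> (count_mem k (unzip1 l') <= N)%N) ->
  schur_list l -> exists l', [/\ schur_list l',
    forall v, lspan (unzip2 l) v -> lspan (unzip2 l') v &
    forall v, geneig k v -> lspan (unzip2 l') v].
Proof.
move=> HN tl.
move: {2}(N.+1 - _)%N (leqnn (N.+1 - count_mem k (unzip1 l))) => n.
elim: n l tl => [|n IH] l tl.
  by rewrite leqn0 subn_eq0 ltnNge HN.
move=> ln; have [sub|] := pselect (forall v, geneig k v -> lspan (unzip2 l) v).
  by exists l.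
move=> /existsNP[w /not_implyP[gw lw]].
have [e tel] := schur_list_extend tl gw lw.
have [|l' [tl' sl' gl']] := IH _ tel.
  by rewrite /= eqxx add1n subSS -ltnS (leq_trans _ ln)// subSn ?HN// .
exists l'; split=> // v lv; apply: sl'; exact: span_cons.
Qed.

Lemma schur_list_covers (s : seq C) :
  (forall k, k \in s -> exists N, forall l, schur_list l ->
     (count_mem k (unzip1 l) <= N)%N) ->
  exists l, schur_list l /\
    forall k v, k \in s -> geneig k v -> lspan (unzip2 l) v.
Proof.
elim: s => [|k s IH] HN; first by exists [::].
have [|l [tl lP]] := IH; first by move=> x xs; apply: HN; rewrite inE xs orbT.
have [|N kN] := HN k; first by rewrite inE eqxx.
have [l' [tl' sl' gl']] := schur_list_cover kN tl.
exists l'; split=> // x v; rewrite inE => /predU1P[->|xs gv]; first exact: gl'.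
by apply: sl'; exact: lP xs gv.
Qed.

End TriangularLists.

(** * Convergence of complex nets *)

Local Notation totally := (@summability.totally _).
#[local] Existing Instance summability.totally_filter.

Lemma near_totally (I : choiceType) (P : {fset I} -> Prop) (A0 : {fset I}) :
  (forall A, (A0 `<=` A)%fset -> P A) -> \forall A \near totally, P A.
Proof. by move=> AP; exists A0. Qed.

Section Cplx.
Variable R : realType.
Local Notation C := (Cplx R).
Local Notation Re := (@complex.Re R).
Local Notation Im := (@complex.Im R).

Lemma cplx_real (z : C) : z \is Num.real -> z = ofR (Re z).
Proof. by move=> zr; rewrite /ofR [X in _ = X]RRe_real. Qed.

Lemma normr_ofR (x : R) : `|ofR x| = ofR `|x|.
Proof.
rewrite normc_def /= expr0n/= addr0.
by congr real_complex_def; rewrite sqrtr_sqr.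
Qed.

Lemma ler_ofR (x y : R) : (ofR x <= ofR y) = (x <= y).
Proof. exact: lecR. Qed.

Lemma ler_cplx_Re (x y : C) : x <= y -> Re x <= Re y.
Proof. by rewrite lecE => /andP[]. Qed.

Lemma ler_Re_norm (z : C) : `|Re z| <= Re `|z|.
Proof. by have := normc_ge_Re z; rewrite lecE => /andP[]. Qed.

Lemma ler_Im_norm (z : C) : `|Im z| <= Re `|z|.
Proof.
have := ler_Re_norm (z * 'i%C).
rewrite [complex.Re (z * _)]ReiNIm normrN normrM.
by rewrite complexiE normCi mulr1.
Qed.

Lemma cvg_cplx (T : Type) (F : set_system T) {FF : Filter F}
    (f : T -> C) (a b : R) :
  Re (f t) @[t --> F] --> a -> Im (f t) @[t --> F] --> b ->
  f @ F --> ((a +i* b)%C : C).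
Proof.
move=> /cvgrPdist_le fa /cvgrPdist_le fb; apply/cvgrPdist_le => e e0.
have er : e = ofR (Re e) by apply: cplx_real; exact: gtr0_real.
have e20 : 0 < Re e / 2.
  by move: e0; rewrite ltcE => /andP[_ ?]; rewrite divr_gt0.
near=> t.
have -> : (a +i* b)%C - f t
          = ofR (a - Re (f t)) + 'i%C * ofR (b - Im (f t)) :> C.
  by rewrite [LHS]complexE /= raddfB; case: (f t).
rewrite (le_trans (ler_normD _ _))// normrM complexiE normCi mul1r !normr_ofR.
rewrite -rmorphD er ler_ofR [leRHS]splitr lerD//.
- by near: t; exact: fa.
- by near: t; exact: fb.
Unshelve. all: by end_near. Qed.

(** The order of [Cplx R] is the partial one of complex numbers: in the limit
    the real parts compare and the imaginary parts stay equal. *)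
Lemma cplx_lim_ge (T : Type) (F : set_system T) {FF : ProperFilter F}
    (f : T -> C) (a l : C) :
  f @ F --> l -> (\forall t \near F, a <= f t) -> a <= l.
Proof.
move=> /cvgrPdist_le fl fa.
have close e : 0 < e -> `|Im l - Im a| <= e /\ Re a <= Re l + e.
  move=> e0; have ofRe0 : 0 < ofR e :> C by rewrite (ltcR 0).
  have [t [/ler_cplx_Re lt]] := filter_ex (filterI (fl _ ofRe0) fa).
  rewrite lecE => /andP[/eqP <- ?].
  have := ler_Re_norm (l - f t); have := ler_Im_norm (l - f t).
  rewrite !raddfB /= in lt *; move=> Imt Ret; split; first exact: le_trans lt.
  by move: Ret; rewrite ler_norml => /andP[]; lra.
rewrite lecE; apply/andP; split; last first.
  by apply/ler_addgt0Pr => e /close[].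
rewrite -subr_eq0 -normr_le0; apply/ler_addgt0Pr => e /close[].
by rewrite add0r.
Qed.

Lemma cplx_lim_le (T : Type) (F : set_system T) {FF : ProperFilter F}
    (f : T -> C) (a l : C) :
  f @ F --> l -> (\forall t \near F, f t <= a) -> l <= a.
Proof.
move=> fl fa; rewrite -lerN2; apply: (cplx_lim_ge (cvgN fl)).
by near=> t; rewrite lerN2; near: t.
Unshelve. all: by end_near. Qed.

Variable I : choiceType.

Lemma monotone_net_cvg (h : {fset I} -> R) (A0 : {fset I}) (M : R) :
  (forall A B, A0 `<=` A -> A `<=` B -> h A <= h B)%fset ->
  (forall A, A0 `<=` A -> h A <= M)%fset -> cvg (h A @[A --> totally]).
Proof.
move=> hmono hM; pose E := [set h A | A in [set A | A0 `<=` A]%fset].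
have E0 : E (h A0) by exists A0 => //=; exact: fsubset_refl.
have ubE : has_ubound E by exists M => _ [A /= AA0 <-]; exact: hM.
have supE : has_sup E by split=> //; exists (h A0).
apply/cvg_ex; exists (sup E); apply/cvgrPdist_le => e e0.
have [_ [A /= A0A <-] hA] := sup_adherent e0 supE.
apply: (near_totally (A0 := A)) => B AB.
have A0B := fsubset_trans A0A AB.
rewrite ger0_norm ?subr_ge0; last by apply: ub_le_sup => //; exists B.
by have := hmono _ _ A0A AB; lra.
Qed.

(** A completeness statement: the real and imaginary parts of [Phi] are
    differences of bounded monotone nets, since [Re Phi + g], [Im Phi + g] and [g]
    are monotone and bounded. *)
Lemma dominated_net_cvg (Phi : {fset I} -> C) (g : {fset I} -> R)
    (A0 : {fset I}) (M : R) :
  (forall A B, A0 `<=` A -> A `<=` B ->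
     `|Phi B - Phi A| <= ofR (g B - g A))%fset ->
  (forall A, A0 `<=` A -> g A <= M)%fset ->
  cvg (Phi A @[A --> totally]).
Proof.
move=> Phig gM.
have H (p : C -> R) : (forall x y, p (x - y) = p x - p y) ->
    (forall z, `|p z| <= Re `|z|) -> cvg (p (Phi A) @[A --> totally]).
  move=> pB pn.
  have pg A B : (A0 `<=` A)%fset -> (A `<=` B)%fset ->
      `|p (Phi B) - p (Phi A)| <= g B - g A.
    move=> A0A AB; rewrite -pB (le_trans (pn _))//.
    exact: (ler_cplx_Re (Phig _ _ A0A AB)).
  have cg : cvg (g A @[A --> totally]).
    apply: (monotone_net_cvg (A0 := A0) (M := M)) => // A B A0A AB.
    by have := normr_ge0 (p (Phi B) - p (Phi A)); have := pg _ _ A0A AB; lra.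
  have cpg : cvg (p (Phi A) + g A @[A --> totally]).
    apply: (monotone_net_cvg (A0 := A0) (M := p (Phi A0) + (M - g A0) + M)).
      move=> A B A0A AB; have := pg _ _ A0A AB.
      by rewrite ler_norml => /andP[]; lra.
    move=> A A0A; have := pg _ _ (fsubset_refl _) A0A; have := gM _ A0A.
    by rewrite ler_norml => ? /andP[]; lra.
  rewrite (_ : (fun A => p (Phi A)) =
    (fun A => p (Phi A) + g A) - g); first exact: is_cvgB.
  by apply/funext => A; rewrite !fctE addrK.
have /cvg_ex[/= a ca] : cvg (Re (Phi A) @[A --> totally]).
  by apply: H; [move=> [? ?] [? ?]|exact: ler_Re_norm].
have /cvg_ex[/= b cb] : cvg (Im (Phi A) @[A --> totally]).
  by apply: H; [move=> [? ?] [? ?]|exact: ler_Im_norm].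
by apply: (cvgP ((a +i* b)%C : C)); exact: cvg_cplx.
Qed.

Lemma big_fset_sub (idx : C) (op : Monoid.com_law idx) (A B : {fset I})
    (x : I -> C) :
  (A `<=` B)%fset -> \big[op/idx]_(i <- B) x i =
    op (\big[op/idx]_(i <- A) x i) (\big[op/idx]_(i <- (B `\` A)%fset) x i).
Proof.
move=> /fsubsetP AB; rewrite (big_fsetID _ (mem A)); congr (op _ _).
- apply: eq_fbigl => i; rewrite !inE /= andbC.
  by case: (boolP (i \in A)) => //= /AB.
- by apply: eq_fbigl => i; rewrite !inE /= andbC.
Qed.

Lemma abs_summable_cvg (x : I -> C) (M : C) :
  (forall A : {fset I}, \sum_(i <- A) `|x i| <= M) ->
  cvg ((\sum_(i <- A) x i : C) @[A --> totally]).
Proof.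
move=> xM; pose S (A : {fset I}) : C := \sum_(i <- A) `|x i|.
have Sr A : S A \is Num.real by apply: rpred_sum => i _; exact: normr_real.
apply: (dominated_net_cvg (A0 := fset0) (g := fun A => Re (S A)) (M := Re M)).
- move=> A B _ AB; rewrite (big_fset_sub _ _ AB) /= addrC addrK.
  have -> : ofR (Re (S B) - Re (S A)) = S B - S A.
    by rewrite /ofR rmorphB /= -/(ofR _) -/(ofR _) -!cplx_real.
  by rewrite /S (big_fset_sub _ _ AB) /= addrC addrK; exact: ler_norm_sum.
- by move=> A _; exact: (ler_cplx_Re (xM A)).
Qed.

End Cplx.

(** * The inner product of square summable sequences *)

Lemma ler_norm2 (F : numFieldType) (s t : F) : 0 <= s -> 0 <= t ->
  s * t *+ 2 <= s ^+ 2 + t ^+ 2.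
Proof.
by move=> s0 t0; rewrite real_leif_mean_square_scaled// ger0_real.
Qed.

Lemma ler_norm_mul (F : numFieldType) (s t : F) : 0 <= s -> 0 <= t ->
  s * t <= s ^+ 2 + t ^+ 2.
Proof.
move=> s0 t0; apply: le_trans (ler_norm2 s0 t0).
by rewrite mulr2n lerDl mulr_ge0.
Qed.

Section SquareSummable.
Variable R : realType.
Local Notation C := (Cplx R).
Local Notation zseq := (zseq R).
Local Notation ell2 := (@ell2 R).
Implicit Types (u v w : zseq).

Lemma ell2P w :
  ell2 w <->
  exists M : C, forall A : {fset int}, \sum_(n <- A) `|w n| ^+ 2 <= M.
Proof.
have sqE n : `|w n| ^+ 2 = ofR (complex.Re (`|w n| ^+ 2)).
  by apply: cplx_real; rewrite ger0_real// exprn_ge0.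
have sumE (A : {fset int}) :
    \sum_(n <- A) `|w n| ^+ 2 = ofR (\sum_(n <- A) complex.Re (`|w n| ^+ 2)).
  by rewrite /ofR rmorph_sum; apply: eq_bigr => n _; exact: sqE.
have Re_ge0 n : 0 <= complex.Re (`|w n| ^+ 2).
  by rewrite -ler_ofR -sqE exprn_ge0.
split=> [w2|[M wM]].
  pose s := (\esum_(n in [set: int]) (complex.Re (`|w n| ^+ 2))%:E)%E.
  have s0 : (0 <= s)%E by apply: esum_ge0 => n _; rewrite lee_fin.
  have sfin : s \is a fin_num by rewrite ge0_fin_numE.
  exists (ofR (fine s)) => A; rewrite sumE ler_ofR -lee_fin fineK//.
  rewrite -sumEFin; apply: esum_ge; exists [set` A]; first by split.
  by rewrite fsbig_finite//= set_fsetK.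
apply: (@le_lt_trans _ _ (complex.Re M)%:E); last exact: ltry.
apply: ge_ereal_sup => _ [X [finX _] <-].
rewrite fsbig_finite//= sumEFin lee_fin.
by have := wM (fset_set X); rewrite sumE => /ler_cplx_Re.
Qed.

(** The constant is complex; if it is not a nonnegative real number, then [v] is
    zero, since [c |v_n|^2] is nonnegative. *)
Lemma ell2_dominated (c : C) u v :
  (forall n, `|u n| ^+ 2 <= c * `|v n| ^+ 2) -> ell2 v -> ell2 u.
Proof.
move=> uv /ell2P[M vM]; apply/ell2P.
have [c0|c0] := boolP (0 <= c).
  exists (c * M) => A; apply: le_trans (ler_wpM2l c0 (vM A)).
  by rewrite mulr_sumr; apply: ler_sum.
have [[n vn]|v0] := pselect (exists n, v n <> 0).
  have := le_trans (exprn_ge0 2 (normr_ge0 _)) (uv n).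
  rewrite pmulr_lge0 ?(negbTE c0)// exprn_gt0// normr_gt0; exact/eqP.
exists 0 => A; apply: sumr_le0 => n _; apply: le_trans (uv n) _.
have [->|/eqP vn] := eqVneq (v n) 0; first by rewrite normr0 expr0n mulr0.
by case: v0; exists n.
Qed.

Lemma subspace_ell2 : is_subspace ell2.
Proof.
split.
  apply/ell2P; exists 0 => A.
  by rewrite big1// => n _; rewrite normr0 expr0n.
move=> a u v /ell2P[M uM] /ell2P[N vN]; apply/ell2P.
exists ((`|a| ^+ 2 * M + N) *+ 2) => A.
apply: (@le_trans _ _
    (\sum_(n <- A) ((`|a| ^+ 2 * `|u n| ^+ 2 + `|v n| ^+ 2) *+ 2))).
  apply: ler_sum => n _; rewrite !fctE -exprMn -normrM.
  set x := a * u n; set y := v n.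
  apply: (@le_trans _ _ ((`|x| + `|y|) ^+ 2)).
    by rewrite ler_pXn2r ?nnegrE ?addr_ge0//; exact: ler_normD.
  by rewrite sqrrD addrAC [leRHS]mulr2n lerD2l ler_norm2.
by rewrite sumrMnl lerMn2r big_split /= -mulr_sumr lerD// ler_wpM2l.
Qed.

Lemma ell2_shift (k : int) w : ell2 w -> ell2 (fun n => w (n + k)).
Proof.
move=> /ell2P[M wM]; apply/ell2P; exists M => A.
rewrite (le_trans _ (wM [fset (n + k)%R | n in A]%fset))//.
by rewrite big_imfset//= => i j _ _; exact: addIr.
Qed.

Definition dot_sum u v (A : {fset int}) : C := \sum_(n <- A) u n * (v n)^*.

Lemma dotzE u v : dotz u v = lim (dot_sum u v A @[A --> totally]).
Proof.
rewrite /dotz /summability.sum.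
rewrite (_ : summability.partial_sum _ = dot_sum u v)//.
by apply/funext => A; rewrite /dot_sum big_seq_fsetE.
Qed.

Lemma dotz_cvg u v : ell2 u -> ell2 v ->
  dot_sum u v A @[A --> totally] --> (dotz u v : C).
Proof.
move=> /ell2P[M uM] /ell2P[N vN]; rewrite dotzE.
apply: (abs_summable_cvg (M := M + N)) => A.
apply: le_trans (lerD (uM A) (vN A)); rewrite -big_split /=.
by apply: ler_sum => n _; rewrite normrM norm_conjC ler_norm_mul.
Qed.

Lemma dotz_eq u v (f : {fset int} -> C) (l : C) :
  (forall A, f A = dot_sum u v A) -> f A @[A --> totally] --> l -> dotz u v = l.
Proof.
move=> /funext fE; rewrite dotzE -fE => fl.
exact: (cvg_lim (@norm_hausdorff _ C) fl).
Qed.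

Lemma dotz_linear a u v w : ell2 u -> ell2 v -> ell2 w ->
  dotz (a *: u + v) w = a * dotz u w + dotz v w.
Proof.
move=> u2 v2 w2.
apply: (dotz_eq _ (cvgD (cvgM (cvg_cst a) (dotz_cvg u2 w2)) (dotz_cvg v2 w2))).
move=> A; rewrite -[LHS]/(a * dot_sum u w A + dot_sum v w A).
rewrite /dot_sum mulr_sumr -big_split /=.
by apply: eq_bigr => n _; rewrite mulrDl mulrA.
Qed.

Lemma dotz_conj u v : ell2 u -> ell2 v -> dotz v u = (dotz u v)^*.
Proof.
move=> u2 v2.
apply: (dotz_eq (f := fun A => (dot_sum u v A)^*)).
  move=> A; rewrite /dot_sum rmorph_sum /=; apply: eq_bigr => n _.
  by rewrite rmorphM /= conjCK mulrC.
have /cvgrPdist_le uv := dotz_cvg u2 v2.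
apply/cvgrPdist_le => e /uv; apply: filterS => A.
by rewrite -rmorphB norm_conjC.
Qed.

Lemma dotz_ge u n : ell2 u -> `|u n| ^+ 2 <= dotz u u.
Proof.
move=> u2; apply: (cplx_lim_ge (dotz_cvg u2 u2)).
apply: (near_totally (A0 := [fset n]%fset)) => A; rewrite fsub1set => nA.
rewrite /dot_sum (big_fsetD1 n)//= normCK lerDl sumr_ge0// => m _.
by rewrite -normCK exprn_ge0.
Qed.

Lemma dotz_gt0 u : ell2 u -> u <> 0 -> 0 < dotz u u.
Proof.
move=> u2 u0; have [n un] : exists n, u n <> 0.
  by apply/existsNP => u00; apply: u0; apply/funext.
apply: lt_le_trans (dotz_ge n u2); rewrite exprn_gt0// normr_gt0.
exact/eqP.
Qed.

End SquareSummable.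

(** * Eigenvalues of a tridiagonal operator with summable weights *)

Lemma sum_count_le (F : numDomainType) (T : eqType) (f : T -> F) (s t : seq T) :
  (forall x, 0 <= f x) -> uniq s ->
  \sum_(x <- s) f x *+ count_mem x t <= \sum_(x <- t) f x.
Proof.
move=> f0 us; elim: t => [|y t IH]; first by rewrite big_nil big1.
rewrite big_cons /=; under eq_bigr do rewrite mulrnDr.
rewrite big_split /= lerD//.
have [ys|ys] := boolP (y \in s); last first.
  rewrite big_seq big1// => x xs; case: eqP => [yx|//].
  by rewrite yx xs in ys.
rewrite (bigD1_seq y)//= eqxx mulr1n big1 ?addr0// => x.
by rewrite eq_sym => /negbTE ->.
Qed.

Section TridiagOperator.
Variable R : realType.
Local Notation C := (Cplx R).
Local Notation zseq := (zseq R).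
Local Notation ell2 := (@ell2 R).
Implicit Types (u v w : zseq) (l : seq (C * zseq)).
Variables (d rho : int -> R) (r S : C).
Hypothesis rho_le : forall n, `|ofR (rho n)| <= r.
Hypothesis d_summable : forall A : {fset int}, \sum_(n <- A) `|ofR (d n)| <= S.

Definition hop w : zseq := shiftz (diag rho w) - shiftz_adj (diag rho w).
Definition tridiag w : zseq := diag d (hop w).

Local Notation schur := (schur_list ell2 (@dotz R) tridiag).
Local Notation HD := (subspace_ell2 R).
Local Notation dotP := (@dotz_linear R).
Local Notation dot_conj := (@dotz_conj R).
Local Notation dot_gt0 := (@dotz_gt0 R).

Lemma linear_tridiag : linear tridiag.
Proof.
move=> a u v; apply/funext => n.
rewrite /tridiag /hop /diag /shiftz /shiftz_adj !fctE.
have scaleE (x y : C) : x *: (y : C^o) = x * y by [].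
by rewrite !scaleE; ring.
Qed.

Lemma r_ge0 : 0 <= r. Proof. exact: le_trans (normr_ge0 _) (rho_le 0). Qed.

Lemma ell2_hop w : ell2 w -> ell2 (hop w).
Proof.
move=> w2; have rw2 : ell2 (diag rho w).
  apply: (ell2_dominated (c := r ^+ 2)) w2 => n.
  by rewrite -exprMn normrM ler_pXn2r ?nnegrE ?mulr_ge0 ?r_ge0// ler_wpM2r.
exact: (subspaceB HD (ell2_shift (-1) rw2) (ell2_shift 1 rw2)).
Qed.

Lemma ell2_tridiag w : ell2 w -> ell2 (tridiag w).
Proof.
move=> /ell2_hop; apply: (ell2_dominated (c := S ^+ 2)) => n.
have dS : `|ofR (d n)| <= S.
  by have := d_summable [fset n]%fset; rewrite big_seq_fset1.
have S0 := le_trans (normr_ge0 _) dS.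
by rewrite -exprMn normrM ler_pXn2r ?nnegrE ?mulr_ge0// ler_wpM2r.
Qed.

(** The span has a reproducing kernel [g] at [n]: [<x, g> = x_n] for all [x] in
    it, and [g_n] is the sum to be bounded. Then [|g_n|^2 <= <g, g> = g_n], whence
    [g_n <= 1]. *)
Lemma bessel l n : schur l -> \sum_(x <- l) `|x.2 n| ^+ 2 <= 1.
Proof.
move=> tl; pose s : C := \sum_(x <- l) `|x.2 n| ^+ 2.
have [g [lg gP gn]] : exists g, [/\ lspan (unzip2 l) g,
    forall x, lspan (unzip2 l) x -> dotz x g = x n & g n = s].
  rewrite {}/s; elim: l tl => [|[k e] l IH] /=.
    move=> _; exists 0; rewrite big_nil; split=> // x ->.
    rewrite dotzE (_ : dot_sum 0 0 = fun=> 0).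
      exact: (cvg_lim (@norm_hausdorff _ C) (cvg_cst _)).
    by apply/funext => A; rewrite /dot_sum big1// => m _; rewrite mul0r.
  move=> [De ee eo eK tl]; have [g [lg gP gn]] := IH tl.
  have Dg := schur_list_dom HD tl lg.
  exists ((e n)^* *: e + g); split.
  - by exists (e n)^*; rewrite addrC addKr.
  - move=> x [a lx]; have Dx := schur_list_dom HD tl lx.
    rewrite -(subrK (a *: e) x) [_ - _ + _]addrC.
    rewrite (dotPr HD dotP dot_conj)//; last exact: (HD.2).
    rewrite conjCK !dotP// ee (eo _ lg) (gP _ lx).
    rewrite [dotz (x - a *: e) e](dot0l dot_conj)// ?(eo _ lx)//.
    by rewrite !fctE mulr1 mulr0 addr0 add0r mulrC.
  - by rewrite big_cons /= -gn !fctE normCK mulrC.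
have gg : dotz g g = s by rewrite gP.
have := dotz_ge n (schur_list_dom HD tl lg); rewrite gg gn => s2.
have s0 : 0 <= s by apply: sumr_ge0 => x _; exact: exprn_ge0.
rewrite -/s; have [->|sN0] := eqVneq s 0; first exact: ler01.
move: s2; rewrite ger0_norm// expr2 -[leRHS]mulr1 ler_pM2l//.
by rewrite lt_def sN0.
Qed.

Lemma cvg_sum_norm_dot l : (forall x, x \in l -> ell2 x.2) ->
  (\sum_(x <- l) `|dot_sum (tridiag x.2) x.2 A| : C) @[A --> totally] -->
  (\sum_(x <- l) `|dotz (tridiag x.2) x.2| : C).
Proof.
elim: l => [|x l IH] l2.
  rewrite big_nil (_ : (fun A : {fset int} => _) = fun=> 0).
    exact: cvg_cst.
  by apply/funext => A; rewrite big_nil.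
rewrite big_cons (_ : (fun A : {fset int} => _) =
   (fun A => `|dot_sum (tridiag x.2) x.2 A| +
    \sum_(x <- l) `|dot_sum (tridiag x.2) x.2 A|)); last first.
  by apply/funext => A; rewrite big_cons.
have x2 : ell2 x.2 by apply: l2; rewrite inE eqxx.
have IHl := IH (fun y yl => l2 y (mem_behead (s := x :: l) yl)).
have nx : (`|dot_sum (tridiag x.2) x.2 A| : C) @[A --> totally] -->
    (`|dotz (tridiag x.2) x.2| : C).
  exact: (cvg_norm (dotz_cvg (ell2_tridiag x2) x2)).
exact: (cvgD nx IHl).
Qed.

(** Four sums of squares appear, at the indices [n - 1], [n + 1] and twice [n];
    each is at most [1]. *)
Lemma sum_hop_le l n : schur l ->
  \sum_(x <- l) `|hop x.2 n| * `|x.2 n| <= r *+ 4.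
Proof.
move=> tl.
apply: (@le_trans _ _ (\sum_(x <- l) r * (`|x.2 (n - 1)| ^+ 2 + `|x.2 n| ^+ 2
    + `|x.2 (n + 1)| ^+ 2 + `|x.2 n| ^+ 2))).
  apply: ler_sum => x _.
  apply: (@le_trans _ _ (r * (`|x.2 (n - 1)| + `|x.2 (n + 1)|) * `|x.2 n|)).
    apply: ler_wpM2r => //; rewrite mulrDr; apply: le_trans (ler_normB _ _) _.
    by rewrite !normrM lerD// ler_wpM2r.
  rewrite -mulrA ler_wpM2l ?r_ge0// mulrDl -addrA.
  by rewrite lerD// ler_norm_mul.
rewrite -mulr_sumr !big_split /= -[r *+ 4]mulr_natr.
apply: ler_wpM2l; first exact: r_ge0.
have -> : 4%:R = 1 + 1 + 1 + 1 :> C by ring.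
by rewrite !lerD ?bessel.
Qed.

(** The labels are the diagonal entries [<K e, e>]; their finite partial sums over
    the coordinates satisfy the bound, which passes to the limit. *)
Lemma schur_trace_le l : schur l -> \sum_(k <- unzip1 l) `|k| <= r *+ 4 * S.
Proof.
move=> tl; rewrite -(schur_list_diag HD dotP dot_conj tl) big_map.
have l2 x := schur_list_mem tl (x := x).
apply: (cplx_lim_le (cvg_sum_norm_dot l2)); apply: nearW => A.
apply: (@le_trans _ _ (\sum_(x <- l) \sum_(n <- A)
    `|ofR (d n)| * (`|hop x.2 n| * `|x.2 n|))).
  apply: ler_sum => x _; apply: le_trans (ler_norm_sum _ _ _) _.
  by apply: ler_sum => n _; rewrite !normrM norm_conjC mulrA.
rewrite exchange_big /=.
apply: (@le_trans _ _ (\sum_(n <- A) `|ofR (d n)| * (r *+ 4))).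
  by apply: ler_sum => n _; rewrite -mulr_sumr ler_wpM2l// sum_hop_le.
by rewrite -mulr_suml mulrC ler_wpM2l// mulrn_wge0// r_ge0.
Qed.

Definition tridiag_op := Operator ell2 tridiag.

Lemma gen_eigenspaceE k w :
  gen_eigenspace tridiag_op k w <-> geneig ell2 tridiag k w.
Proof.
split=> [[m [w2 mw]]|[w2 [m mw]]]; first by split; [exact: (w2 0%N)|exists m].
exists m; split=> // j _; elim: j => //= j j2.
apply: subspaceB => //; [exact: HD|exact: ell2_tridiag|].
by apply: subspaceZ => //; exact: HD.
Qed.

Lemma schur_count_le k : k != 0 -> exists N, forall l, schur l ->
  (count_mem k (unzip1 l) <= N)%N.
Proof.
move=> k0; pose x := complex.Re (r *+ 4 * S / `|k|).
exists (Num.bound x) => l tl.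
have cx : (count_mem k (unzip1 l))%:R <= x.
  rewrite -ler_ofR /ofR rmorph_nat.
  have le : (count_mem k (unzip1 l))%:R <= r *+ 4 * S / `|k|.
    rewrite ler_pdivlMr ?normr_gt0//; apply: le_trans (schur_trace_le tl).
    elim: (unzip1 l) => [|y s IH]; first by rewrite big_nil mul0r.
    rewrite big_cons /= natrD mulrDl lerD//; case: eqP => [->|_].
      by rewrite mul1r.
    by rewrite mul0r.
  rewrite (le_trans le)// [leRHS]RRe_real// ger0_real//; exact: le_trans le.
by rewrite -(ler_nat R) (le_trans cx)// ltW// archi_boundP// (le_trans _ cx).
Qed.

Let schur_cover l k := schur_list_cover HD linear_tridiag ell2_tridiag
  dotP dot_conj dot_gt0 (l := l) (k := k).

Let schur_covers := schur_list_covers HD linear_tridiag ell2_tridiag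
  dotP dot_conj dot_gt0.

(** The junk value of [alg_mult] does not occur: a list that covers the
    generalized eigenspace exhibits a finite basis of it. *)
Lemma has_dim_alg_mult k : k != 0 ->
  has_dim (gen_eigenspace tridiag_op k) (alg_mult tridiag_op k).
Proof.
move=> k0; have [N kN] := schur_count_le k0.
have [//|l [_ _ lP]] := schur_cover (l := [::]) kN.
have [bs [fbs bsP]] := subspace_basis (subspace_geneig HD linear_tridiag k) lP.
apply: (@xgetPex _ 0%N [set m | has_dim _ m]); exists (size bs).
exists (fun i => bs`_i); split=> [i|c|v /gen_eigenspaceE /bsP /spanP//].
- apply/gen_eigenspaceE/bsP/spanP; exists (fun j => (i == j)%:R).
  rewrite (bigD1 i)//= eqxx scale1r big1 ?addr0// => j ji.
  by rewrite eq_sym (negbTE ji) scale0r.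
- exact: indep_coef.
Qed.

Lemma alg_mult_gt0 k : k != 0 -> point_spectrum tridiag_op k ->
  (0 < alg_mult tridiag_op k)%N.
Proof.
move=> k0 [w [w2 w0 kw]]; have [b [_ _ bP]] := has_dim_alg_mult k0.
have [|c wc] := bP w.
  apply/gen_eigenspaceE; split=> //; exists 1%N.
  by rewrite /= (_ : tridiag w = k *: w)// subrr.
rewrite lt0n; apply: contra_notN w0 => /eqP m0.
by rewrite wc big1// => -[i im]; exfalso; rewrite m0 in im.
Qed.

(** Summability of the eigenvalues with multiplicities, with a bound that is
    uniform in the finite set [s]. *)
Lemma sum_alg_mult_le (s : seq C) : uniq s -> 0 \notin s ->
  \sum_(k <- s) `|k| *+ alg_mult tridiag_op k <= r *+ 4 * S.
Proof.
move=> us s0.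
have sN0 k : k \in s -> k != 0 by apply: contraTneq => ->.
have [k ks|l [tl lP]] := schur_covers (s := s); first exact/schur_count_le/sN0.
apply: le_trans (schur_trace_le tl).
apply: le_trans (sum_count_le _ (@normr_ge0 _ C) us).
rewrite big_seq [leRHS]big_seq; apply: ler_sum => k ks.
apply: ler_wpMn2l => //.
have [b [bW fb _]] := has_dim_alg_mult (sN0 _ ks).
have [bs [sbs bsP]] := geneig_schur_list HD linear_tridiag k tl.
apply: leq_trans sbs; apply: indep_size fb _ => i.
by have /gen_eigenspaceE gb := bW i; apply: bsP => //; exact: lP gb.
Qed.

End TridiagOperator.

(** * Infinite products *)

Section InfiniteProduct.
Variable R : realType.
Local Notation C := (Cplx R).

Lemma prod_1D_sub1_le (s : seq C) : \sum_(z <- s) `|z| <= 2^-1 ->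
  `|\prod_(z <- s) (1 + z) - 1| <= (\sum_(z <- s) `|z|) *+ 2.
Proof.
elim: s => [|z s IH]; first by rewrite !big_nil subrr normr0.
rewrite !big_cons => zs.
have s2 : \sum_(z <- s) `|z| <= 2^-1 by apply: le_trans zs; rewrite lerDr.
set P := \prod_(z <- s) (1 + z).
have P1 := IH s2.
have P2 : `|P| <= 2%:R.
  rewrite -[P](subrK 1) (le_trans (ler_normD _ _))// normr1.
  rewrite -[leRHS]/(1 + 1) lerD2r (le_trans P1)//.
  by rewrite -mulr_natr -ler_pdivlMr ?ltr0n// mul1r.
have -> : (1 + z) * P - 1 = z * P + (P - 1) by ring.
rewrite (le_trans (ler_normD _ _))// mulrnDl lerD// normrM -mulr_natr.
exact: ler_wpM2l.
Qed.

Variables (I : choiceType) (x : I -> C) (m : I -> nat) (M : C).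
Let P (A : {fset I}) : C := \prod_(i <- A) (1 + x i) ^+ m i.
Let t (A : {fset I}) : C := \sum_(i <- A) `|x i| *+ m i.
Hypothesis tM : forall A, t A <= M.

Let t_ge0 A : 0 <= t A.
Proof. by apply: sumr_ge0 => i _; rewrite mulrn_wge0. Qed.

Let t_sub A B : (A `<=` B)%fset -> t B = t A + t (B `\` A)%fset.
Proof. exact: big_fset_sub. Qed.

Let P_sub A B : (A `<=` B)%fset -> P B = P A * P (B `\` A)%fset.
Proof. exact: big_fset_sub. Qed.

(** A power is a product of equal factors, each of which has its own share of the
    weight. *)
Let P_sub1_le A : t A <= 2^-1 -> `|P A - 1| <= t A *+ 2.
Proof.
pose s := flatten [seq nseq (m i) (x i) | i <- A].
have -> : t A = \sum_(z <- s) `|z|.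
  rewrite /s big_flatten big_map; apply: eq_bigr => i _.
  by rewrite big_nseq iter_addr_0.
have -> : P A = \prod_(z <- s) (1 + z).
  rewrite /s big_flatten big_map; apply: eq_bigr => i _.
  by rewrite big_nseq iter_mulr_1.
exact: prod_1D_sub1_le.
Qed.

Let tail_small : exists A0 : {fset I}, forall A, (A0 `<=` A)%fset ->
  t (A `\` A0)%fset <= 4^-1.
Proof.
pose E := range (fun A => complex.Re (t A)).
have supE : has_sup E.
  split; first by exists (complex.Re (t fset0)); exists fset0.
  by exists (complex.Re M) => _ [A _ <-]; exact: ler_cplx_Re.
have e0 : 0 < 4^-1 :> R by rewrite invr_gt0.
have [_ [A0 _ <-] A0E] := sup_adherent e0 supE.
exists A0 => A A0A.
have /= AE : E (complex.Re (t A)) by exists A.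
have := ub_le_sup supE.2 AE.
rewrite (t_sub A0A) raddfD /= => le.
have -> : 4^-1 = ofR 4^-1 :> C by rewrite /ofR fmorphV rmorph_nat.
rewrite [leLHS]cplx_real ?ger0_real// ler_ofR; lra.
Qed.

(** Beyond a finite set [A0] the weights sum up to at most [1/4], so every tail
    product is within [1/2] of [1]. Hence the partial products beyond [A0] vary by
    at most a constant times the weights, which makes the net converge, and their
    moduli stay above [|P A0| / 2], which keeps the limit away from [0]. *)
Lemma infinite_product : exists L : C, P A @[A --> totally] --> L /\
  ((forall i, (1 + x i) ^+ m i != 0) -> L != 0).
Proof.
have [A0 tA0] := tail_small.
have le42 : 4^-1 <= 2^-1 :> C by rewrite lef_pV2 ?posrE// ler_nat.
have P1 A : (A0 `<=` A)%fset -> `|P (A `\` A0)%fset - 1| <= 2^-1.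
  move=> A0A; rewrite (le_trans (P_sub1_le (le_trans (tA0 _ A0A) le42)))//.
  rewrite -[leLHS]mulr_natr -ler_pdivlMr// (le_trans (tA0 _ A0A))//.
  by rewrite -invfM -natrM.
have P2 A : (A0 `<=` A)%fset -> `|P (A `\` A0)%fset| <= 2%:R.
  move=> A0A; rewrite -[P _](subrK 1) (le_trans (ler_normD _ _))// normr1.
  rewrite -[leRHS]/(1 + 1) lerD2r (le_trans (P1 _ A0A))//.
  by rewrite invf_le1// ler1n.
have cP : cvg (P A @[A --> totally]).
  pose c := `|P A0| * 2%:R * 2%:R.
  have c0 : 0 <= c by rewrite !mulr_ge0.
  have ctr A : c * t A \is Num.real by rewrite ger0_real// mulr_ge0.
  apply: (dominated_net_cvg (A0 := A0) (g := fun A => complex.Re (c * t A))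
    (M := complex.Re (c * M))) => [A B A0A AB|A _]; last first.
    by apply: ler_cplx_Re; apply: ler_wpM2l.
  rewrite /ofR rmorphB /= -!/(ofR _) -!cplx_real// (P_sub AB) (t_sub AB).
  have -> : c * (t A + t (B `\` A)%fset) - c * t A = c * t (B `\` A)%fset.
    by ring.
  have -> : P A * P (B `\` A)%fset - P A = P A * (P (B `\` A)%fset - 1) by ring.
  rewrite (P_sub A0A) !normrM /c -[_ * _ * t _]mulrA; apply: ler_pM => //.
    by apply: ler_wpM2l => //; exact: P2.
  rewrite mulr_natl; apply: P_sub1_le.
  apply: le_trans le42; apply: le_trans (tA0 _ (fsubset_trans A0A AB)).
  rewrite [leRHS](t_sub (A := (B `\` A)%fset)) ?lerDl//.
  by apply: fsetDS.
exists (lim (P A @[A --> totally])); split=> // Pn0.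
have PA0 : P A0 != 0.
  by rewrite /P prodf_seq_neq0; apply/allP => i _; exact: Pn0.
have : `|P A0| / 2 <= `|lim (P A @[A --> totally])|.
  apply: (cplx_lim_ge (cvg_norm cP)); apply: (near_totally (A0 := A0)) => A A0A.
  rewrite (P_sub A0A) normrM ler_wpM2l//.
  have -> : 2^-1 = 1 - 2^-1 :> C by field.
  rewrite lerBlDr -lerBlDl -{1}(normr1 C) (le_trans (lerB_dist _ _))//.
  by rewrite distrC P1.
by apply: contraTneq => ->; rewrite normr0 lt_geF// divr_gt0// normr_gt0.
Qed.

End InfiniteProduct.

(** * Zeros of the determinant *)

Section Determinant.
Variable R : realType.
Local Notation C := (Cplx R).
Variables (d rho : int -> R) (r S : C).
Hypothesis rho_le : forall n, `|ofR (rho n)| <= r.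
Hypothesis d_summable : forall A : {fset int}, \sum_(n <- A) `|ofR (d n)| <= S.

Lemma fredholm_det_tridiag_eq0 :
  fredholm_det (tridiag_op d rho) = 0 <->
  point_spectrum (tridiag_op d rho) (-1).
Proof.
set T := tridiag_op d rho.
(* Extending the multiplicity by 0 turns the product over the eigenvalues into
   one over all complex numbers. *)
pose m k : nat := if k \in point_spectrum T then alg_mult T k else 0%N.
pose P (A : {fset C}) : C := \prod_(k <- A) (1 + k) ^+ m k.
have detE : fredholm_det T = lim (P A @[A --> totally]).
  rewrite /fredholm_det (_ : (fun A : {fset C} => _) = P)//.
  apply/funext => A; rewrite big_mkcond; apply: eq_bigr => k _.
  by rewrite /m; case: ifP.
rewrite detE; split=> [P0|specN1]; last first.
  apply: (lim_near_cst (@norm_hausdorff _ C)).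
  apply: (near_totally (A0 := [fset (-1 : C)]%fset)) => A.
  rewrite fsub1set => NA.
  have N1 : -1 != 0 :> C by rewrite oppr_eq0 oner_neq0.
  rewrite /P (big_fsetD1 (-1))//= subrr /m mem_set// expr0n.
  by rewrite eqn0Ngt (alg_mult_gt0 rho_le d_summable)// mul0r.
have mM (A : {fset C}) : \sum_(k <- A) `|k| *+ m k <= r *+ 4 * S.
  apply: le_trans
    (sum_alg_mult_le rho_le d_summable (s := [seq k <- A | k != 0]) _ _).
  - rewrite big_filter [leRHS]big_mkcond; apply: ler_sum => k _.
    have [->|k0] := eqVneq k 0; first by rewrite normr0 mul0rn.
    by rewrite /m; case: ifP => // _; rewrite mulr0n mulrn_wge0.
  - by rewrite filter_uniq // fset_uniq.
  - by rewrite mem_filter eqxx.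
have [L [PL L0]] := infinite_product mM.
have PE : lim (P A @[A --> totally]) = L.
  exact: (cvg_lim (@norm_hausdorff _ C) PL).
apply: contrapT => specN1.
suff /L0 : forall k : C, (1 + k) ^+ m k != 0 by rewrite -PE P0 eqxx.
move=> k; rewrite /m; case: ifPn => [|_]; last by rewrite expr0 oner_neq0.
rewrite inE => kT; apply: expf_neq0; apply: contra_notN specN1.
by rewrite addrC addr_eq0 => /eqP <-.
Qed.

End Determinant.

(** * The vorticity operator *)

Section Coefficients.
Variable R : realType.
Local Notation C := (Cplx R).

Lemma sqr_enorm (v : int * int) :
  enorm R v ^+ 2 = v.1%:~R ^+ 2 + v.2%:~R ^+ 2.
Proof. by rewrite sqr_sqrtr// addr_ge0// sqr_ge0. Qed.

Lemma sqr_enorm_int (v : int * int) :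
  enorm R v ^+ 2 = (v.1 ^+ 2 + v.2 ^+ 2)%:~R.
Proof. by rewrite sqr_enorm rmorphD !rmorphXn. Qed.

(** The squared norm of a lattice vector is [0], with inverse [0], or at least
    [1]. *)
Lemma rho_bounded p q n : `|rho R p q n| <= 1 + enorm R p ^+ 2.
Proof.
rewrite /rho (le_trans (ler_normB _ _))// normr1 lerD2l.
rewrite normrM ger0_norm ?sqr_ge0//.
rewrite ler_piMr ?sqr_ge0// normfV sqr_enorm_int.
set X : int := _ + _.
have X0 : 0 <= X by rewrite addr_ge0// sqr_ge0.
have [->|XN0] := eqVneq X 0; first by rewrite normr0 invr0.
have X1 : 1 <= X by rewrite -gtz0_ge1 lt_def XN0.
by rewrite ger0_norm ?ler0z// invf_le1 ?ltr0z ?ler1z// (lt_le_trans ltr01).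
Qed.

Lemma sum_inv_1Dsqr_le N : \sum_(0 <= i < N) (1 + i%:R ^+ 2)^-1 <= 4%:R :> R.
Proof.
(* Telescoping: [1 / (1 + i^2) <= 4 / (i + 1) - 4 / (i + 2)]. *)
suff : \sum_(0 <= i < N) (1 + i%:R ^+ 2)^-1 <= 4 - 4 / (N%:R + 1) :> R.
  by move=> /le_trans; apply; rewrite gerBl divr_ge0// addr_ge0.
elim: N => [|N IH]; first by rewrite big_geq// add0r divr1 subrr.
rewrite big_nat_recr//= (le_trans (lerD IH (lexx _)))//.
rewrite -[N.+1%:R]natr1; set x : R := N%:R; have x0 : 0 <= x by exact: ler0n.
rewrite -subr_ge0.
have -> : 4 - 4 / (x + 1 + 1) - (4 - 4 / (x + 1) + (1 + x ^+ 2)^-1) =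
   (3 * x ^+ 2 - 3 * x + 2) / ((x + 1) * (x + 2) * (1 + x ^+ 2)).
  by field; rewrite !gt_eqF//; nra.
by rewrite divr_ge0//; nra.
Qed.

Lemma sum_int_inv_1Dsqr_le (A : {fset int}) :
  \sum_(n <- A) (1 + n%:~R ^+ 2)^-1 <= 8%:R :> R.
Proof.
pose N := (\sum_(n <- A) absz n)%N.+1.
pose s := [seq Posz i | i <- iota 0 N] ++ [seq Negz i | i <- iota 0 N].
pose f (n : int) : R := (1 + n%:~R ^+ 2)^-1.
have f0 n : 0 <= f n by rewrite invr_ge0 addr_ge0// sqr_ge0.
have As n : n \in A -> n \in s.
  move=> nA; have nN : (absz n < N)%N.
    by rewrite ltnS (big_fsetD1 n)//= leq_addr.
  rewrite mem_cat; case: n nN {nA} => n nN.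
    by apply/orP; left; apply: (map_f Posz); rewrite mem_iota add0n; exact: nN.
  apply/orP; right; apply: (map_f Negz).
  by rewrite mem_iota add0n; exact: ltnW nN.
apply: (@le_trans _ _ (\sum_(n <- s) f n)).
  apply: le_trans (sum_count_le s f0 (fset_uniq A)).
  rewrite big_seq [leRHS]big_seq; apply: ler_sum => n nA.
  have : (0 < count_mem n s)%N by rewrite -has_count has_pred1 As.
  by case: (count_mem n s) => // k _; rewrite mulrS lerDl mulrn_wge0.
have S4 := sum_inv_1Dsqr_le N; rewrite /index_iota subn0 in S4.
rewrite big_cat !big_map /= (_ : 8%:R = 4%:R + 4%:R); last by ring.
rewrite lerD// (le_trans _ S4)//; apply: ler_sum => i _.
(* [Negz i] is [- (i + 1)]: the negative half is dominated by the other. *)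
rewrite /f NegzE lef_pV2 ?posrE ?ltr_pwDl// ?sqr_ge0//.
rewrite lerD2l rmorphN sqrrN /= ler_pXn2r ?nnegrE//.
by rewrite -pmulrn ler_nat.
Qed.

(** Parallelogram law, as [n p = (q + n p) - q] has norm at least [|n|]. *)
Lemma sqr_int_le (p q : int * int) (n : int) : p <> 0 ->
  n%:~R ^+ 2 <= 2 * enorm R (q + p *~ n) ^+ 2 + 2 * enorm R q ^+ 2 :> R.
Proof.
move=> p0; have p1 : 1 <= (p.1%:~R ^+ 2 + p.2%:~R ^+ 2 : R).
  rewrite -sqr_enorm sqr_enorm_int ler1z -gtz0_ge1.
  rewrite lt_def addr_ge0 ?sqr_ge0// andbT.
  rewrite paddr_eq0 ?sqr_ge0// !sqrf_eq0.
  by apply: contra_notN p0; case: p => a b /= /andP[/eqP -> /eqP ->].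
rewrite !sqr_enorm /= !raddfMz /= !rmorphD /= !rmorphMz /=.
rewrite -[p.1%:~R *~ n]mulrzr -[p.2%:~R *~ n]mulrzr.
move: p1; move: (p.1%:~R : R) (p.2%:~R : R) (q.1%:~R : R) (q.2%:~R : R).
move: (n%:~R : R) => z x y a b xy1; rewrite -subr_ge0.
have -> : 2 * ((a + x * z) ^+ 2 + (b + y * z) ^+ 2)
    + 2 * (a ^+ 2 + b ^+ 2) - z ^+ 2
  = z ^+ 2 * (x ^+ 2 + y ^+ 2 - 1)
    + (2 * a + x * z) ^+ 2 + (2 * b + y * z) ^+ 2.
  by ring.
do 2 (apply: addr_ge0; last exact: sqr_ge0).
by rewrite mulr_ge0 ?sqr_ge0 ?subr_ge0.
Qed.

Variables (nu : R) (p q : int * int) (lam : R).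
Hypotheses (nu0 : 0 < nu) (p0 : p <> 0) (lam0 : 0 < lam).
Let X n : R := enorm R (q + p *~ n) ^+ 2.
Let den n : R := nu * X n + lam.

Lemma den_gt0 n : 0 < den n.
Proof. by rewrite ltr_wpDl// mulr_ge0 ?sqr_ge0// ltW. Qed.

(** The first summand absorbs the multiple of [X n] by means of [nu * X n], the
    second one the constant by means of [lam]. *)
Let c : R := 2 / nu + (2 * enorm R q ^+ 2 + 1) / lam.

Lemma c_ge0 : 0 <= c.
Proof.
have Q0 := sqr_ge0 (enorm R q).
by apply: addr_ge0; apply: divr_ge0; rewrite ?(ltW nu0) ?(ltW lam0)//; lra.
Qed.

Lemma sqr_le_den n : 1 + n%:~R ^+ 2 <= c * den n.
Proof.
have := sqr_int_le q n p0; rewrite -/(X n) => nX.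
have X0 : 0 <= X n by exact: sqr_ge0.
have -> : c * den n = 2 * X n + (2 * enorm R q ^+ 2 + 1)
    + 2 * lam / nu + (2 * enorm R q ^+ 2 + 1) * (nu * X n) / lam.
  by rewrite /c /den; field; rewrite !gt_eqF.
have Q0 := sqr_ge0 (enorm R q).
rewrite -addrA ler_wpDr//; last by lra.
have Q1 : 0 <= 2 * enorm R q ^+ 2 + 1 by lra.
have [nu1 lam1] := (ltW nu0, ltW lam0).
apply: addr_ge0; first by rewrite divr_ge0// mulr_ge0.
by rewrite divr_ge0// mulr_ge0// mulr_ge0.
Qed.

Let d n : R := (- nu * X n - lam)^-1.
Let rh := rho R p q.

Lemma dE n : d n = - (den n)^-1.
Proof. by rewrite /d /den mulNr -opprD invrN. Qed.

Lemma norm_d_le n : (1 + n%:~R ^+ 2) * `|d n| <= c.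
Proof.
rewrite dE normrN ger0_norm ?invr_ge0 ?(ltW (den_gt0 n))//.
by rewrite ler_pdivrMr ?den_gt0 ?sqr_le_den.
Qed.

Lemma sum_d_le (A : {fset int}) : \sum_(n <- A) `|ofR (d n)| <= ofR (c * 8%:R).
Proof.
under eq_bigr do rewrite normr_ofR.
rewrite /ofR -rmorph_sum -!/(ofR _) ler_ofR.
apply: (@le_trans _ _ (\sum_(n <- A) c * (1 + n%:~R ^+ 2)^-1)); last first.
  by rewrite -mulr_sumr ler_wpM2l ?c_ge0 ?sum_int_inv_1Dsqr_le.
apply: ler_sum => n _; rewrite ler_pdivlMr ?ltr_pwDl ?sqr_ge0// mulrC.
exact: norm_d_le.
Qed.

Lemma norm_rho_le n : `|ofR (rh n)| <= ofR (1 + enorm R p ^+ 2).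
Proof. by rewrite normr_ofR ler_ofR rho_bounded. Qed.

Lemma Kop_tridiag : Kop nu p q lam = tridiag_op d rh.
Proof. by []. Qed.

Lemma LB_hop w n : LB nu p q w n = hop rh w n - ofR (nu * X n) * w n.
Proof. by []. Qed.

(** [(K w + w)_n = d_n (L w - lam w)_n], where [d_n] is not zero. *)
Lemma LB_eigen (w : zseq R) :
  LB nu p q w = ofR lam *: w <-> Kop nu p q lam w = -1 *: w.
Proof.
have den0 n : ofR (den n) != 0 :> C.
  by rewrite /ofR fmorph_eq0 gt_eqF// den_gt0.
have eqs n : LB nu p q w n = (ofR lam *: w) n <->
    Kop nu p q lam w n = (-1 *: w) n.
  rewrite LB_hop Kop_tridiag /tridiag_op /= /tridiag /diag dE.
  rewrite -[X in _ <-> _ = X]/(-1 * w n) -[X in _ = X <-> _]/(ofR lam * w n).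
  have -> : ofR (- (den n)^-1) = - (ofR (den n))^-1.
    by rewrite /ofR rmorphN fmorphV.
  have denE : ofR (den n) = ofR (nu * X n) + ofR lam by rewrite /ofR rmorphD.
  rewrite !mulNr mul1r; split=> [h|/oppr_inj h].
    have -> : hop rh w n = ofR (den n) * w n.
      by rewrite denE mulrDl -h addrC subrK.
    by rewrite mulKf.
  have -> : hop rh w n = ofR (den n) * w n by rewrite -h mulVKf.
  by rewrite denE mulrDl addrAC subrr add0r.
by split=> h; apply/funext => n; apply/eqs; rewrite h.
Qed.

(** [n^2 w_n = - n^2 d_n (H w)_n], where [n^2 d_n] is bounded. *)
Lemma Kop_eigen_dom (w : zseq R) : ell2 w -> Kop nu p q lam w = -1 *: w ->
  ell2 (fun n => n%:~R ^+ 2 * w n).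
Proof.
move=> w2 Kw.
apply: (ell2_dominated (c := ofR c ^+ 2)) (ell2_hop norm_rho_le w2) => n.
have -> : w n = - (ofR (d n) * hop rh w n).
  have := congr1 (fun u : zseq R => u n) Kw.
  rewrite Kop_tridiag /= /tridiag /diag => ->.
  by rewrite -[X in - X]/(-1 * w n) mulN1r opprK.
rewrite mulrN normrN mulrA -exprMn normrM.
rewrite ler_pXn2r ?nnegrE ?mulr_ge0//; last first.
  by rewrite (ler_ofR 0) c_ge0.
apply: ler_wpM2r => //.
have -> : n%:~R ^+ 2 * ofR (d n) = ofR (n%:~R ^+ 2 * d n).
  by rewrite /ofR rmorphM rmorphXn /= rmorph_int.
rewrite normr_ofR ler_ofR normrM ger0_norm ?sqr_ge0//.
rewrite (le_trans _ (norm_d_le n))//.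
by rewrite ler_wpM2r// lerDr.
Qed.

Lemma point_spectrum_LB_Kop :
  point_spectrum (LB nu p q) (ofR lam) <-> point_spectrum (Kop nu p q lam) (-1).
Proof.
split=> [[w [[w2 _] w0 /LB_eigen Kw]]|[w [w2 w0 Kw]]]; exists w; split=> //.
  by split=> //; exact: Kop_eigen_dom.
exact/LB_eigen.
Qed.

End Coefficients.

Theorem theorem3p1 (R : realType) (nu : R) (p q : int * int) (lam : R)
  (hnu : 0 < nu) (hp : p <> 0) (hq : Qset R p q) (hpar : ~ parallel q p)
  (hlam : 0 < lam) :
  (point_spectrum (LB nu p q) (ofR lam) <->
     fredholm_det (Kop nu p q lam) = 0) /\
  (fredholm_det (Kop nu p q lam) = 0 <->
     point_spectrum (Kop nu p q lam) (- 1)).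
Proof.
have det : fredholm_det (Kop nu p q lam) = 0 <->
    point_spectrum (Kop nu p q lam) (- 1).
  exact: (fredholm_det_tridiag_eq0 (@norm_rho_le R p q)
    (sum_d_le q hnu hp hlam)).
by split=> //; rewrite det; exact: (point_spectrum_LB_Kop q hnu hp hlam).
Qed.
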